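(* For any hypercube $Q_n$ with $n\geq 3$, $\mathrm{fgndi}_{\sum}(Q_n)=2$.
   Context: $Q_n$ is the $n$-dimensional hypercube graph: its vertices are the $0$-$1$ strings of length $n$, two being adjacent if and only if they differ in exactly one coordinate. For a finite simple graph $G$ and an integer $k\ge 1$, a non-proper total $k$-coloring is an arbitrary map $f: V(G)\cup E(G)\rightarrow \{1,2,\dots,k\}$. Its weight function is $$\phi(x)=f(x)+\sum_{e\ni x}f(e)+\sum_{y\in N(x)}f(y)\quad (x\in V(G)),$$ where the first sum is over the edges $e$ incident with $x$ and $N(x)=\{y\in V(G): xy\in E(G)\}$. The coloring $f$ is called a neighbor full sum distinguishing (NFSD) total $k$-coloring if $\phi(x)\neq\phi(y)$ for every edge $xy\in E(G)$. The neighbor full sum distinguishing total chromatic number $\mathrm{fgndi}_{\sum}(G)$ is the smallest $k$ for which $G$ has an NFSD total $k$-coloring. *)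

(* Defs.v *)
From mathcomp Require Import all_boot.
Set Implicit Arguments.
Unset Strict Implicit.
Unset Printing Implicit Defensive.

Record sgraph := SGraph {
  vertex :> finType;
  adj : rel vertex;
  adj_sym : symmetric adj;
  adj_irr : irreflexive adj
}.

Definition edge_set (G : sgraph) : {set {set G}} :=
  [set E : {set G} | [exists x, exists y, adj x y && (E == [set x; y])]].

Definition edge (G : sgraph) : finType := {E : {set G} | E \in edge_set G}.

Section Coloring.
Variable G : sgraph.

Definition total_coloring (k : nat) (f : G + edge G -> nat) : Prop :=
  forall z, 1 <= f z <= k.

Definition weight (f : G + edge G -> nat) (x : G) : nat :=
  f (inl x) + \sum_(e : edge G | x \in val e) f (inr e)
    + \sum_(y : G | adj x y) f (inl y).

Definition nfsd (f : G + edge G -> nat) : Prop :=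
  forall x y : G, adj x y -> weight f x <> weight f y.

Definition nfsd_colorable (k : nat) : Prop :=
  exists f : G + edge G -> nat, total_coloring k f /\ nfsd f.

(* [fgndi_eq k] says that the neighbor full sum distinguishing total chromatic
   number of G exists and equals k.  It is a relation and not a function
   because some graphs, such as K_2, have no NFSD total coloring at all. *)
Definition fgndi_eq (k : nat) : Prop :=
  [/\ 1 <= k, nfsd_colorable k
    & forall j, 1 <= j -> nfsd_colorable j -> k <= j].

End Coloring.

Section Hypercube.
Variable n : nat.

Definition cube_adj : rel (n.-tuple bool) :=
  fun x y => #|[set i : 'I_n | tnth x i != tnth y i]| == 1.

Lemma cube_adj_sym : symmetric cube_adj.
Proof.
by move=> x y; congr (_ == _); apply: eq_card => i; rewrite !inE eq_sym.
Qed.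

Lemma cube_adj_irr : irreflexive cube_adj.
Proof.
move=> x; rewrite /cube_adj (_ : [set _ | _] = set0) ?cards0 //.
by apply/setP=> i; rewrite !inE eqxx.
Qed.

Definition hypercube : sgraph := SGraph cube_adj_sym cube_adj_irr.

End Hypercube.

(* Main.v *)
Require Import Defs.
From mathcomp Require Import all_boot.
Set Implicit Arguments.
Unset Strict Implicit.
Unset Printing Implicit Defensive.

(** The cube is regular of degree [n >= 2] and bipartite, the two sides being
    the strings of even and of odd parity; these properties alone settle the
    question.

    Two colours suffice: colour every edge 1, the vertices of one side 2 and
    those of the other side 1.  In a [d]-regular graph each vertex then gets
    weight [d] from its edges, and the two sides have the constant weights
    [2 + d + d * 1] and [1 + d + d * 2], which differ as soon as [d != 1].

    One colour does not suffice: the only colouring is constant, every vertex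
    has weight [1 + d + d], and some edge exists because [d > 0]. *)

(** Joining [x] to a neighbour [y] gives the edge [[set x; y]], and [y] is
    recovered from it because [y] differs from [x]. *)
Lemma card_incident_edges (G : sgraph) (x : G) :
  #|[pred e : edge G | x \in val e]| = #|[pred y | adj x y]|.
Proof.
have injx : {in [pred y | adj x y] &, injective (fun y => [set x; y])}.
  move=> y z /= axy _ eqE.
  have: y \in [set x; z] by rewrite -eqE set22.
  rewrite !inE => /orP[/eqP yx | /eqP //].
  by move: axy; rewrite yx inE adj_irr.
rewrite -(card_in_imset injx) -(card_imset _ val_inj).
apply: eq_card => E; apply/imsetP/imsetP => [[e xe ->] | [y axy ->]].
  have := valP e; rewrite inE => /existsP[u /existsP[v /andP[auv /eqP eE]]].
  move: xe; rewrite inE eE !inE => /orP[] /eqP ->; first by exists v.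
  by exists u; rewrite ?inE 1?adj_sym // setUC.
have exy : [set x; y] \in edge_set G.
  rewrite inE; apply/existsP; exists x; apply/existsP; exists y.
  by rewrite eqxx andbT.
by exists (exist (fun E => is_true (E \in edge_set G)) _ exy) => //; apply: set21.
Qed.

Lemma weight_regular (G : sgraph) (d : nat) (f : G + edge G -> nat) (x : G)
    (c : nat) :
    #|[pred y | adj x y]| = d -> (forall e, f (inr e) = 1) ->
    (forall y, adj x y -> f (inl y) = c) ->
  weight f x = f (inl x) + d + d * c.
Proof.
move=> dx fe fy; rewrite /weight.
rewrite (eq_bigr (fun=> 1)) => [|e _]; last exact: fe.
by rewrite sum1_card card_incident_edges (eq_bigr _ fy) sum_nat_const dx.
Qed.

(** The condition [1 < d] cannot be relaxed to [0 < d]: in a disjoint union of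
    edges, the two ends of an edge always have the same weight. *)
Lemma fgndi_regular_bipartite (G : sgraph) (d : nat) (side : G -> bool) (x0 : G) :
    1 < d -> (forall x : G, #|[pred y | adj x y]| = d) ->
    (forall x y : G, adj x y -> side y = ~~ side x) ->
  fgndi_eq G 2.
Proof.
move=> d_gt1 degG sideG; split=> //.
  pose f (z : G + edge G) := if z is inl x then (side x).+1 else 1.
  exists f; split=> [[x|e] //=|x y axy]; first by case: (side x).
  have wf z : weight f z = (side z).+1 + d + d * (~~ side z).+1.
    by apply: weight_regular => // u azu; rewrite /= (sideG z u).
  have neq : 2 + d + d * 1 != 1 + d + d * 2.
    by rewrite muln1 muln2 -addnn addnA !eqn_add2r eqSS ltn_eqF.
  rewrite !wf (sideG _ _ axy) negbK; apply/eqP.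
  by case: (side x); rewrite // eq_sym.
case=> [|[|j]] // _ [f [f1 fdist]].
have {}f1 z : f z = 1 by apply/eqP; rewrite eqn_leq andbC f1.
have /card_gt0P[y x0y] : 0 < #|[pred y | adj x0 y]| by rewrite degG ltnW.
case: (fdist _ _ x0y).
by rewrite !(@weight_regular _ d _ _ 1) // !f1.
Qed.

Section CubeStructure.
Variable n : nat.
Implicit Types x y : n.-tuple bool.

Definition flip x (i : 'I_n) : n.-tuple bool :=
  [tuple tnth x j (+) (j == i) | j < n].

Lemma cube_adjP x y : reflect (exists i, y = flip x i) (cube_adj x y).
Proof.
apply: (iffP cards1P) => -[i xy]; exists i.
  apply: eq_from_tnth => j; rewrite tnth_mktuple.
  by move/setP/(_ j): xy; rewrite !inE => <-; case: (tnth x j); case: (tnth y j).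
by apply/setP => j; rewrite xy !inE tnth_mktuple; case: (tnth x j); case: (j == i).
Qed.

Lemma flip_inj x : injective (flip x).
Proof.
move=> i j /(congr1 (fun t => tnth t i)); rewrite !tnth_mktuple eqxx.
by move/addbI/esym/eqP.
Qed.

Lemma cube_degree x : #|[pred y | cube_adj x y]| = n.
Proof.
rewrite -[RHS]card_ord -(card_codom (@flip_inj x)).
apply: eq_card => y; rewrite inE.
by apply/cube_adjP/codomP.
Qed.

Definition parity x : bool := \big[addb/false]_i tnth x i.

Lemma parity_adj x y : cube_adj x y -> parity y = ~~ parity x.
Proof.
case/cube_adjP => i ->; rewrite /parity.
have flips1 : \big[addb/false]_(j < n) (j == i) = true.
  by rewrite (bigD1 i) //= eqxx big1 // => j /negbTE.
under eq_bigr do rewrite tnth_mktuple.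
by rewrite big_split /= flips1 addbT.
Qed.

End CubeStructure.

Theorem theorem13 (n : nat) (hn : 3 <= n) : fgndi_eq (hypercube n) 2.
Proof.
apply: (@fgndi_regular_bipartite (hypercube n) n (@parity n) [tuple of nseq n false]).
- exact: ltnW.
- exact: cube_degree.
- exact: parity_adj.
Qed.
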